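(* Let $N\ge 1$, let $\theta_1,\dots,\theta_N>0$ and $\eta_1,\dots,\eta_N>0$, and let $A=(a_{ij})_{1\le i,j\le N}$ be the symmetric matrix with $a_{ii}=2\eta_i$ and $a_{ij}=\theta_{\min(i,j)}$ for $i\ne j$. If $A$ is a $B$-matrix, then for every $Q>0$ the Optimal Execution Problem of minimizing $\mathcal{C}(\xi)$ over $\xi\in\Xi_N(Q)$ has a unique solution and is strongly well-posed.
   Context: A real $N\times N$ matrix $A=(a_{i,k})$ is a $B$-matrix if for all $i=1,\dots,N$: $\sum_{k=1}^N a_{i,k}>0$ and $\frac1N\sum_{k=1}^N a_{i,k}>a_{i,j}$ for all $j\ne i$. Model. The noises $\varepsilon_1,\dots,\varepsilon_N$ are independent with $\varepsilon_i\sim\mathcal{N}(0,\sigma_i^2)$; $\mathcal{F}_i=\sigma(\varepsilon_1,\dots,\varepsilon_i)$ is the filtration induced by them ($\mathcal{F}_0$ trivial). The impact coefficients $\theta_k$ (permanent) and $\eta_k$ (temporary) are positive and $\mathcal{F}_0$-measurable (deterministic), and $S_0$ is a constant. For trades $\xi_1,\dots,\xi_N$, the market price is $S_k=S_{k-1}+\theta_k\xi_k+\varepsilon_k$ and the execution price is $\tilde S_k=S_{k-1}+\eta_k\xi_k$. The expected cost is $\mathcal{C}(\xi)=\mathbb{E}\big[QS_0+\sum_{i=1}^N\xi_i\tilde S_i\,\big|\,\mathcal{F}_0\big]$. For $Q>0$ (initial inventory to be sold), $\Xi_N(Q)$ is the set of real-valued processes $\xi=(\xi_1,\dots,\xi_N)$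 with $\sum_{i=1}^N\xi_i=-Q$, $\xi_i$ being $\mathcal{F}_{i-1}$-measurable, and such that there is $M>0$ with $|\xi_i|<M$ for all $i$. Trades of either sign are allowed. Random strategies are identified when equal almost surely. The problem is well-posed in the Hadamard sense if a solution exists, is unique, and is stable, i.e. depends continuously on the data $(Q,\theta_1,\dots,\theta_N,\eta_1,\dots,\eta_N)$. It is strongly well-posed if it is well-posed in the Hadamard sense and its optimal liquidation strategy is monotone: the optimal sell program satisfies $\xi_i\le 0$ for all $i=1,\dots,N$. *)

(* Defs.v *)
From HB Require Import structures.
From mathcomp Require Import all_boot all_order all_algebra.
From mathcomp Require Import all_classical all_reals all_analysis.

Set Implicit Arguments.
Unset Strict Implicit.
Unset Printing Implicit Defensive.

Import Order.TTheory GRing.Theory Num.Theory.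
Import numFieldNormedType.Exports.

Local Open Scope classical_set_scope.
Local Open Scope ring_scope.

(* Indices 1, ..., N are represented by the ordinals 0, ..., N-1 of 'I_N:
   the ordinal i stands for the trading date i+1. *)

Definition B_matrix (R : realFieldType) (N : nat) (A : 'M[R]_N) : Prop :=
  forall i : 'I_N,
    0 < \sum_k A i k /\
    forall j : 'I_N, j != i -> A i j < N%:R^-1 * \sum_k A i k.

Definition impact_matrix (R : realFieldType) (N : nat)
    (theta eta : 'rV[R]_N) : 'M[R]_N :=
  \matrix_(i, j) if i == j then 2 * eta 0 i else theta 0 (Order.min i j).

(* [normal_prob m 0] is not a point mass in the library, so the degenerate
   normal law is given separately. *)
Definition gaussian (R : realType) (m s : R) : set R -> \bar R :=
  if s == 0 then \d_m else normal_prob m s.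

Definition mutually_independent (d : measure_display) (T : measurableType d)
    (R : realType) (P : probability T R) (N : nat)
    (X : 'I_N -> {RV P >-> R}) : Prop :=
  forall (J : {set 'I_N}) (B : 'I_N -> set R),
    (forall j, j \in J -> measurable (B j)) ->
    P (\bigcap_(j in [set` J]) X j @^-1` B j) =
    (\prod_(j in J) P (X j @^-1` B j))%E.

Definition gaussian_noises (d : measure_display) (T : measurableType d)
    (R : realType) (P : probability T R) (N : nat)
    (sigma : 'I_N -> R) (eps : 'I_N -> {RV P >-> R}) : Prop :=
  mutually_independent eps /\
  forall (i : 'I_N) (B : set R), measurable B ->
    distribution P (eps i) B = gaussian 0 (sigma i) B.

(* [filtration eps k] is the sigma-algebra generated by the first k noises;
   for k = 0 it is trivial. *)
Definition filtration (d : measure_display) (T : measurableType d)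
    (R : realType) (P : probability T R) (N : nat)
    (eps : 'I_N -> {RV P >-> R}) (k : nat) : set (set T) :=
  <<s \bigcup_(i in [set i : 'I_N | (i < k)%N])
        preimage_set_system setT (eps i) measurable >>.

Definition measurable_wrt (T : Type) (R : realType) (G : set (set T))
    (f : T -> R) : Prop :=
  forall B : set R, measurable B -> G (f @^-1` B).

Definition is_cond_expectation (d : measure_display) (T : measurableType d)
    (R : realType) (P : probability T R) (G : set (set T))
    (X Y : T -> R) : Prop :=
  [/\ measurable_wrt G Y,
      P.-integrable setT (EFin \o Y) &
      forall B, G B ->
        (\int[P]_(w in B) (Y w)%:E = \int[P]_(w in B) (X w)%:E)%E].

(* A version of E[X | G], chosen among all versions. *)
Definition cond_expectation (d : measure_display) (T : measurableType d)
    (R : realType) (P : probability T R) (G : set (set T))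
    (X : T -> R) : T -> R :=
  xget (fun=> 0) [set Y | is_cond_expectation P G X Y].

(* S_k = S_(k-1) + theta_k xi_k + eps_k; the date k+1 is the ordinal k, and the
   price is left constant after the horizon N. *)
Fixpoint market_price (T : Type) (R : realType) (N : nat) (S0 : R)
    (theta : 'rV[R]_N) (eps xi : 'I_N -> T -> R) (k : nat) (w : T) : R :=
  if k is k'.+1 then
    market_price S0 theta eps xi k' w +
    (if insub k' is Some i then theta 0 i * xi i w + eps i w else 0)
  else S0.

(* At the ordinal i, i.e. at date i+1, the preceding market price is S_i. *)
Definition execution_price (T : Type) (R : realType) (N : nat) (S0 : R)
    (theta eta : 'rV[R]_N) (eps xi : 'I_N -> T -> R) (i : 'I_N) (w : T) : R :=
  market_price S0 theta eps xi i w + eta 0 i * xi i w.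

Definition expected_cost (d : measure_display) (T : measurableType d)
    (R : realType) (P : probability T R) (N : nat) (S0 : R)
    (eps : 'I_N -> {RV P >-> R}) (Q : R) (theta eta : 'rV[R]_N)
    (xi : 'I_N -> T -> R) : T -> R :=
  cond_expectation P (filtration eps 0)
    (fun w => Q * S0 +
      \sum_(i < N) xi i w * execution_price S0 theta eta eps xi i w).

(* Strategies are identified when almost surely equal, so the liquidation
   constraint and the bound are required almost surely. *)
Definition admissible (d : measure_display) (T : measurableType d)
    (R : realType) (P : probability T R) (N : nat)
    (eps : 'I_N -> {RV P >-> R}) (Q : R) (xi : 'I_N -> T -> R) : Prop :=
  [/\ forall i : 'I_N, measurable_wrt (filtration eps i) (xi i),
      {ae P, forall w, \sum_(i < N) xi i w = - Q} &
      exists2 M : R, 0 < M &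
        forall i : 'I_N, {ae P, forall w, `|xi i w| < M}].

Definition optimal (d : measure_display) (T : measurableType d)
    (R : realType) (P : probability T R) (N : nat) (S0 : R)
    (eps : 'I_N -> {RV P >-> R}) (Q : R) (theta eta : 'rV[R]_N)
    (xi : 'I_N -> T -> R) : Prop :=
  admissible eps Q xi /\
  forall zeta : 'I_N -> T -> R, admissible eps Q zeta ->
    {ae P, forall w, expected_cost S0 eps Q theta eta xi w <=
                     expected_cost S0 eps Q theta eta zeta w}.

Definition has_unique_solution (d : measure_display) (T : measurableType d)
    (R : realType) (P : probability T R) (N : nat) (S0 : R)
    (eps : 'I_N -> {RV P >-> R}) (Q : R) (theta eta : 'rV[R]_N) : Prop :=
  exists2 xi : 'I_N -> T -> R, optimal S0 eps Q theta eta xi &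
    forall zeta : 'I_N -> T -> R, optimal S0 eps Q theta eta zeta ->
      forall i : 'I_N, {ae P, forall w, zeta i w = xi i w}.

Definition positive_data (R : realType) (N : nat) (Q : R)
    (theta eta : 'rV[R]_N) : Prop :=
  0 < Q /\ forall i : 'I_N, 0 < theta 0 i /\ 0 < eta 0 i.

(* Continuity at (Q, theta, eta) of the map sending the data to the solution,
   for the L^oo distance between strategies: the map is defined at all
   neighbouring positive data, and its values there are close. *)
Definition stable (d : measure_display) (T : measurableType d)
    (R : realType) (P : probability T R) (N : nat) (S0 : R)
    (eps : 'I_N -> {RV P >-> R}) (Q : R) (theta eta : 'rV[R]_N) : Prop :=
  forall xi : 'I_N -> T -> R, optimal S0 eps Q theta eta xi ->
  forall e : R, 0 < e ->
    \forall q \near Q & D \near (theta, eta),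
      positive_data q D.1 D.2 ->
      has_unique_solution S0 eps q D.1 D.2 /\
      forall zeta : 'I_N -> T -> R, optimal S0 eps q D.1 D.2 zeta ->
        forall i : 'I_N, {ae P, forall w, `|zeta i w - xi i w| < e}.

Definition Hadamard_well_posed (d : measure_display) (T : measurableType d)
    (R : realType) (P : probability T R) (N : nat) (S0 : R)
    (eps : 'I_N -> {RV P >-> R}) (Q : R) (theta eta : 'rV[R]_N) : Prop :=
  has_unique_solution S0 eps Q theta eta /\ stable S0 eps Q theta eta.

Definition strongly_well_posed (d : measure_display) (T : measurableType d)
    (R : realType) (P : probability T R) (N : nat) (S0 : R)
    (eps : 'I_N -> {RV P >-> R}) (Q : R) (theta eta : 'rV[R]_N) : Prop :=
  Hadamard_well_posed S0 eps Q theta eta /\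
  forall xi : 'I_N -> T -> R, optimal S0 eps Q theta eta xi ->
    forall i : 'I_N, {ae P, forall w, xi i w <= 0}.

(* Main.v *)
(** Summing by parts, the noise term of the cost is a sum of the products
    [eps_j * xi_i] with [i <= j] and, because of the constraint
    [sum_i xi_i = - Q], of deterministic multiples of the [eps_j]; as [eps_j] is
    centred and independent of [F_(j-1)], all of them have zero mean, so that
    the cost is [E (xi^T A xi) / 2].

    If [A] is a symmetric B-matrix with row sums [r_i], then
    [D_ij = a_ij - r_i / N] has zero row sums and negative off-diagonal entries,
    i.e. [- D] is the generator of an irreducible Markov chain, and its left
    null vectors have entries of one sign.  Every [y] with [y^T A] a multiple of
    [1^T] is such a null vector.  Taking the multiple to be [0], this makes [A]
    injective; the same holds for [A + t I] with [t >= 0], so the least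
    eigenvalue of [A] is positive.  Hence the minimizer is the deterministic
    [- Q A^-1 1 / (1^T A^-1 1)], of one sign again.  It depends continuously on
    the data through the adjugate of [A], and the B-matrix condition is open. *)
Require Import Defs.
From mathcomp Require Import all_boot all_order all_algebra.
From mathcomp Require Import all_classical all_reals all_analysis.
From mathcomp Require Import measurable_realfun.
From mathcomp Require Import ring lra.

Set Implicit Arguments.
Unset Strict Implicit.
Unset Printing Implicit Defensive.

Import Order.TTheory GRing.Theory Num.Theory.
Import numFieldNormedType.Exports.

Local Open Scope classical_set_scope.
Local Open Scope ring_scope.

(** * Centred Gaussian noise *)

(** The Radon-Nikodym derivative of [normal_prob m s] agrees almost everywhere with the density,
    both having the same integral over every measurable set. *)
Lemma ge0_integral_normal_prob (R : realType) (m s : R)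
  (f : R -> \bar R) :
  (forall x, 0 <= f x)%E -> measurable_fun setT f ->
  (\int[normal_prob m s]_x f x =
   \int[lebesgue_measure]_x (f x * (normal_pdf m s x)%:E))%E.
Proof.
move=> f0 mf.
have dom := normal_prob_dominates m s.
rewrite -(Radon_Nikodym_SigmaFinite.change_of_variables dom)//.
have mpdf : measurable_fun setT (fun x => (normal_pdf m s x)%:E).
  by apply/measurable_EFinP; exact: measurable_normal_pdf.
have mrn := Radon_Nikodym_SigmaFinite.f_integrable dom.
apply: ae_eq_integral => //.
- by apply: emeasurable_funM => //; exact: measurable_int mrn.
- exact: emeasurable_funM.
apply: ae_eqe_mul2l; apply: integral_ae_eq => // E _ mE.
by rewrite -Radon_Nikodym_SigmaFinite.f_integral.
Qed.

(** Used to bound the first absolute moment, since the density of twice the deviation has a known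
    integral. With [v = |x| / (2 |s|)] the two exponentials differ by the factor
    [expR (3 / 2 * v ^+ 2)], which is at least [1 + v ^+ 2], hence at least [2 * v]. *)
Lemma abs_mul_normal_pdf_le (R : realType) (s x : R) : s != 0 ->
  `|x| * normal_pdf 0 s x <=
  `|s| * normal_peak s / normal_peak (2 * s) * normal_pdf 0 (2 * s) x.
Proof.
move=> s0; have s20 : 2 * s != 0 by rewrite mulf_neq0.
have p0 := normal_peak_gt0 s20.
rewrite !normal_pdfE// /normal_fun subr0.
set a := normal_peak s; set b := normal_peak (2 * s).
rewrite [leRHS](_ : _ = a * (`|s| * expR (- x ^+ 2 / ((2 * s) ^+ 2 *+ 2))));
  last by field; rewrite gt_eqF.
rewrite mulrCA ler_wpM2l ?normal_peak_ge0//.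
set v := `|x| / (2 * `|s|).
have s0' : 0 < `|s| by rewrite normr_gt0.
have vE : v ^+ 2 = x ^+ 2 / (4 * s ^+ 2).
  by rewrite /v expr_div_n exprMn !real_normK ?num_real//; field.
have -> : - x ^+ 2 / ((2 * s) ^+ 2 *+ 2) =
    - x ^+ 2 / (s ^+ 2 *+ 2) + 3 / 2 * v ^+ 2 by rewrite vE; field.
rewrite expRD mulrCA mulrC ler_wpM2l ?expR_ge0//.
have -> : `|x| = `|s| * (2 * v) by rewrite /v; field; rewrite gt_eqF.
rewrite ler_wpM2l//; apply: le_trans (expR_ge1Dx _).
by have := sqr_ge0 (v - 1); nra.
Qed.

(** The density is even, so the reflection [x |-> - x] exchanges the two half-lines. With
    nonnegative integrands, this form of centring requires no integrability. *)
Lemma normal_prob_pos_part_sym (R : realType) (s : R) : s != 0 ->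
  (\int[normal_prob 0 s]_x (Num.max (- x) 0)%:E =
   \int[normal_prob 0 s]_x (Num.max x 0)%:E)%E.
Proof.
move=> s0.
have mmaxx : measurable_fun setT (fun x : R => Num.max x 0).
  exact: measurable_maxr.
have mmaxN : measurable_fun setT (fun x : R => Num.max (- x) 0).
  exact: measurable_maxr.
rewrite ge0_integral_normal_prob; last 2 first.
- by move=> x; rewrite lee_fin le_max lexx orbT.
- exact/measurable_EFinP.
rewrite ge0_integral_normal_prob; last 2 first.
- by move=> x; rewrite lee_fin le_max lexx orbT.
- exact/measurable_EFinP.
pose g (x : R) := Num.max (- x) 0 * normal_pdf 0 s x.
(* The integrand vanishes on the positive half-line; the bound [- 0] is what reflecting [[0, +oo[]
   produces. *)
have -> : (\int[lebesgue_measure]_x ((Num.max (- x) 0)%:E * (normal_pdf 0 s x)%:E) =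
  \int[lebesgue_measure]_(x in `]-oo, (- 0)%R]) (g x)%:E)%E.
  rewrite [RHS]integral_mkcond; apply: eq_integral => x _.
  rewrite patchE; case: ifPn => //.
  rewrite notin_setE /= in_itv/= oppr0 => /negP; rewrite -ltNge => x0.
  by rewrite max_r ?mul0e// oppr_le0 ltW.
have -> : (\int[lebesgue_measure]_x ((Num.max x 0)%:E * (normal_pdf 0 s x)%:E) =
  \int[lebesgue_measure]_(x in `[0%R, +oo[) ((g \o -%R) x)%:E)%E.
  rewrite [RHS]integral_mkcond; apply: eq_integral => x _.
  rewrite patchE; case: ifPn => /=.
    by rewrite /g opprK !normal_pdfE// /normal_fun !subr0 sqrrN.
  rewrite notin_setE /= in_itv/= andbT => /negP; rewrite -ltNge => x0.
  by rewrite max_r ?mul0e// ltW.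
apply: ge0_integration_by_substitutionNy.
- apply: continuous_subspaceT => x; apply: cvgM; last exact: continuous_normal_pdf.
  apply: (@continuous_max _ _ (fun x => - x) (cst 0)); last exact: cst_continuous.
  exact: oppr_continuous.
- by move=> x _; rewrite mulr_ge0 ?normal_pdf_ge0// le_max lexx orbT.
Qed.

Lemma normal_prob_abs_lty (R : realType) (s : R) : s != 0 ->
  (\int[normal_prob 0 s]_x `|x|%:E < +oo)%E.
Proof.
move=> s0; have mabs : measurable_fun setT (fun x : R => `|x|) by [].
rewrite ge0_integral_normal_prob//; last exact/measurable_EFinP.
have mpdf t : measurable_fun setT (normal_pdf (0 : R) t).
  exact: measurable_normal_pdf.
apply: (@le_lt_trans _ _ (\int[lebesgue_measure]_x
    ((`|s| * normal_peak s / normal_peak (2 * s))%:E *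
     (normal_pdf 0 (2 * s) x)%:E))%E).
  apply: ge0_le_integral => //.
  - by move=> x _; rewrite -EFinM lee_fin mulr_ge0 ?normal_pdf_ge0.
  - by apply: emeasurable_funM; apply/measurable_EFinP; [exact: mabs|exact: mpdf].
  - by apply: emeasurable_funM => //; apply/measurable_EFinP; exact: mpdf.
  - by move=> x _; rewrite -!EFinM lee_fin; exact: abs_mul_normal_pdf_le.
rewrite ge0_integralZl//; last 3 first.
- by apply/measurable_EFinP; exact: mpdf.
- by move=> x _; rewrite lee_fin normal_pdf_ge0.
- by rewrite lee_fin !mulr_ge0 ?invr_ge0 ?normal_peak_ge0.
by rewrite integral_normal_pdf mule1 ltry.
Qed.

Section independent_noise.
Context (R : realType) (d : measure_display) (T : measurableType d)
  (P : probability T R).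

(** By independence of [X] from the single event [A], the image under [X] of [P] restricted to [A]
    is [P A] times the law of [X]. *)
Lemma ge0_integral_indep (X : {RV P >-> R}) (A : set T) (f : R -> \bar R) :
  measurable A ->
  (forall B, measurable B ->
    P (A `&` X @^-1` B) = P A * P (X @^-1` B))%E ->
  measurable_fun setT f -> (forall x, 0 <= f x)%E ->
  (\int[P]_(w in A) f (X w) = P A * \int[distribution P X]_x f x)%E.
Proof.
move=> mA indep mf f0.
have mfX : measurable_fun setT (f \o X) by exact: measurableT_comp.
transitivity (\int[mrestr P mA]_w f (X w))%E.
  rewrite [RHS](@ge0_negligible_integral _ _ _ _ _ (~` A))//; last 2 first.
  - exact: measurableC.
  - by rewrite /= /mrestr setICl measure0.
  rewrite setTD setCK; apply: eq_measure_integral => B mB BA.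
  by rewrite /= /mrestr setIidl.
have -> : (\int[mrestr P mA]_w f (X w) =
    \int[pushforward (mrestr P mA) X]_x f x)%E.
  by rewrite ge0_integral_pushforward.
pose a : {nonneg R} := NngNum (fine_ge0 (measure_ge0 P A)).
have aE : a%:num%:E = P A by rewrite fineK// fin_num_measure.
rewrite -aE -ge0_integral_mscale//.
apply: eq_measure_integral => B mB _.
rewrite /= /pushforward /mrestr /mscale /= setIC indep//.
by congr (_ * _)%E; rewrite -aE.
Qed.

Variables (N : nat) (sigma : 'I_N -> R) (eps : 'I_N -> {RV P >-> R}).
Hypothesis heps : gaussian_noises sigma eps.

Lemma ge0_integral_law_eps (i : 'I_N) (f : R -> \bar R) :
  measurable_fun setT f -> (forall x, 0 <= f x)%E ->
  (\int[distribution P (eps i)]_x f x =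
   if sigma i == 0%R then f 0%R
   else \int[normal_prob 0%R (sigma i)]_x f x)%E.
Proof.
move=> mf f0; case: ifPn => s0.
  transitivity (\int[\d_(0%R : R)]_x f x)%E.
    apply: eq_measure_integral => B mB _.
    by have := heps.2 i B mB; rewrite /gaussian s0.
  by rewrite integral_dirac// diracT mul1e.
(* [normal_prob] lives on a copy of [R] with another display, whence the detour
   by the identity function. *)
have mid : measurable_fun setT (idfun : measurableTypeR R -> R).
  by move=> _ B mB; rewrite setTI.
transitivity (\int[pushforward (normal_prob 0%R (sigma i))
    (idfun : measurableTypeR R -> R)]_x f x)%E.
  apply: eq_measure_integral => // B mB _.
  by have := heps.2 i B mB; rewrite /gaussian (negbTE s0).
by rewrite ge0_integral_pushforward.
Qed.

Lemma integrable_eps (i : 'I_N) : P.-integrable setT (EFin \o eps i).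
Proof.
apply/integrableP; split; first exact/measurable_EFinP.
rewrite -[ltLHS](@ge0_integral_distribution _ _ _ _ _ _ _
  (fun x : R => `|x|%:E))//; last first.
  exact/measurable_EFinP.
rewrite ge0_integral_law_eps//; last exact/measurable_EFinP.
case: ifPn => s0; last exact: normal_prob_abs_lty.
by rewrite normr0 ltry.
Qed.

Lemma law_eps_pos_part_sym (i : 'I_N) :
  (\int[distribution P (eps i)]_x (Num.max (- x) 0)%:E =
   \int[distribution P (eps i)]_x (Num.max x 0)%:E)%E.
Proof.
rewrite ge0_integral_law_eps; last 2 first.
- by apply/measurable_EFinP; exact: measurable_maxr.
- by move=> x; rewrite lee_fin le_max lexx orbT.
rewrite ge0_integral_law_eps; last 2 first.
- by apply/measurable_EFinP; exact: measurable_maxr.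
- by move=> x; rewrite lee_fin le_max lexx orbT.
by case: ifPn => s0; [rewrite oppr0|exact: normal_prob_pos_part_sym].
Qed.

(** By independence and symmetry, the positive and negative parts of the noise both integrate over
    [A] to [P A] times the same half-moment; integrability makes it finite, so the difference is
    zero. *)
Lemma integral_eps_indep (i : 'I_N) (A : set T) : measurable A ->
  (forall B, measurable B ->
    P (A `&` eps i @^-1` B) = P A * P (eps i @^-1` B))%E ->
  (\int[P]_(w in A) (eps i w)%:E = 0)%E.
Proof.
move=> mA indep; rewrite integralE.
have max0 (x : R) : (0 <= (Num.max x 0)%:E)%E by rewrite lee_fin le_max lexx orbT.
have mm1 : measurable_fun setT (fun x : R => (Num.max x 0)%:E).
  by apply/measurable_EFinP; exact: measurable_maxr.
have mm2 : measurable_fun setT (fun x : R => (Num.max (- x) 0)%:E).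
  by apply/measurable_EFinP; exact: measurable_maxr.
have negE : (\int[P]_(w in A) ((fun w => (eps i w)%:E)^\- w) =
   P A * \int[distribution P (eps i)]_x (Num.max x 0)%:E)%E.
  rewrite -law_eps_pos_part_sym -ge0_integral_indep//.
  by apply: eq_integral => w _; rewrite funenegE EFin_max.
have posE : (\int[P]_(w in A) ((fun w => (eps i w)%:E)^\+ w) =
   P A * \int[distribution P (eps i)]_x (Num.max x 0)%:E)%E.
  rewrite -ge0_integral_indep//.
  by apply: eq_integral => w _; rewrite funeposE EFin_max.
rewrite negE -posE subee//; apply: integrable_pos_fin_num => //.
by apply: integrableS (integrable_eps i).
Qed.

End independent_noise.

(** * Orthogonality of the noise to the past *)

Section filtration_theory.
Context (R : realType) (d : measure_display) (T : measurableType d)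
  (P : probability T R) (N : nat) (eps : 'I_N -> {RV P >-> R}).

Lemma filtration_sub_measurable (k : nat) :
  filtration eps k `<=` measurable.
Proof.
apply: smallest_sub; first exact: sigma_algebra_measurable.
move=> A [i _ [B mB <-]]; rewrite setTI.
exact: measurable_funPTI.
Qed.

Lemma filtration_le (i k : nat) : (i <= k)%N ->
  filtration eps i `<=` filtration eps k.
Proof.
move=> ik; apply: sub_sigma_algebra2; move=> A [j /= ji Aj].
by exists j => //=; exact: leq_trans ik.
Qed.

Lemma filtration0 (A : set T) : filtration eps 0 A -> A = set0 \/ A = setT.
Proof.
rewrite /filtration => /(_ [set B | B = set0 \/ B = setT]); apply; split.
- split; first by left.
  + by move=> B [->|->]; rewrite ?setD0 ?setDv; [right|left].
  + move=> F hF; have [[n Fn]|Fn0] := pselect (exists n, F n = setT).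
      by right; rewrite -subTset => x _; exists n => //; rewrite Fn.
    left; rewrite -subset0 => x [n _].
    by case: (hF n) => [->//|FnT]; case: Fn0; exists n.
- by move=> B [i].
Qed.

Lemma measurable_wrt_measurable_fun (k : nat) (f : T -> R) :
  measurable_wrt (filtration eps k) f -> measurable_fun setT f.
Proof.
by move=> mf _ B mB; rewrite setTI; apply: filtration_sub_measurable; exact: mf.
Qed.

Lemma measurable_wrt_cst (k : nat) (r : R) :
  measurable_wrt (filtration eps k) (cst r).
Proof.
move=> B mB; rewrite preimage_cst.
have [F0 FD _] : sigma_algebra setT (filtration eps k).
  exact: smallest_sigma_algebra.
by case: ifP => _ //; rewrite -(setD0 setT); exact: FD.
Qed.

(** A pi-system for [filtration eps k]. Taking the family [B] total makes cylinders intersect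
    coordinatewise. *)
Definition cylinders (k : nat) : set (set T) :=
  [set A | exists2 B : 'I_N -> set R, (forall j, measurable (B j)) &
    A = \bigcap_(j in [set` [set j : 'I_N | (j < k)%N]%SET]) eps j @^-1` B j].

(** Dynkin's pi-lambda theorem: the cylinders are closed under intersection, so their Dynkin system
    is the sigma-algebra they generate. *)
Lemma filtration_cylinders (k : nat) :
  filtration eps k `<=` <<d cylinders k >>.
Proof.
rewrite setI_closed_g_dynkin_g_sigma_algebra; last first.
  move=> _ _ [B mB ->] [C mC ->]; exists (fun j => B j `&` C j).
    by move=> j; exact: measurableI.
  by rewrite -bigcapI.
apply: sub_sigma_algebra2 => _ [i /= ik [B mB <-]].
(* A generating event of [eps i] is the cylinder with full sets at the other coordinates. *)
exists (fun j => if j == i then B else setT).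
  by move=> j; case: ifP.
rewrite setTI; apply/seteqP; split => [w Bw j|w /(_ i)]; last first.
  by rewrite /= eqxx; apply; rewrite inE.
by move=> _ /=; case: eqP => // ->.
Qed.

Variable sigma : 'I_N -> R.
Hypothesis heps : gaussian_noises sigma eps.

Lemma cylinder_indep (k : 'I_N) (A : set T) : cylinders k A ->
  forall B, measurable B ->
    P (A `&` eps k @^-1` B) = (P A * P (eps k @^-1` B))%E.
Proof.
move=> [C mC ->] B mB.
pose J := [set j : 'I_N | (j < k)%N]%SET.
(* [D] puts [B] at the index [k] of the family [C]. Mutual independence is then applied to [J] and
   to [k |: J], whose products differ by the factor of [k]. *)
pose D j := if j == k then B else C j.
have kJ : k \notin J by rewrite inE ltnn.
have mD j : measurable (D j) by rewrite /D; case: ifP.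
have DC j : j \in J -> D j = C j.
  by rewrite /D inE; case: eqP => // ->; rewrite ltnn.
have -> : \bigcap_(j in [set` J]) eps j @^-1` C j `&` eps k @^-1` B =
    \bigcap_(j in [set` (k |: J)%SET]) eps j @^-1` D j.
  apply/seteqP; split => [w [Cw Bw] j|w Dw].
    rewrite /= !inE => /orP[/eqP ->|jk]; first by rewrite /D eqxx.
    by rewrite /= DC ?inE//; apply: Cw; rewrite /= inE.
  split; last by have := Dw k; rewrite /= /D eqxx; apply; rewrite !inE eqxx.
  by move=> j /= jJ; have := Dw j; rewrite /= DC//; apply; rewrite finset.in_setU jJ orbT.
rewrite (heps.1 (k |: J)%SET D)// (heps.1 J C)//.
rewrite big_setU1//= {1}/D eqxx muleC; congr (_ * _)%E.
by apply: eq_bigr => j jJ; rewrite DC.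
Qed.

(** The events over which [eps k] integrates to zero form a Dynkin system containing the cylinders.
    The latter are independent of [eps k] because [filtration eps k] involves only the noises of
    index strictly below [k]. *)
Lemma integral_eps_filtration (k : 'I_N) (A : set T) :
  filtration eps k A -> (\int[P]_(w in A) (eps k w)%:E = 0)%E.
Proof.
have intE := integrable_eps heps k.
have int0 : (\int[P]_w (eps k w)%:E = 0)%E.
  apply: (integral_eps_indep heps) => // B mB.
  by rewrite setTI probability_setT mul1e.
move=> /filtration_cylinders.
suff : <<d cylinders k >> `<=`
    [set A | measurable A /\ (\int[P]_(w in A) (eps k w)%:E = 0)%E].
  by move=> /[apply] -[].
apply: smallest_sub; last first.
  move=> B cB; have mB : measurable B.
    case: cB => C mC ->; apply: fin_bigcap_measurable => // j _.
    exact: measurable_funPTI.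
  by split => //; apply: (integral_eps_indep heps) => //; exact: cylinder_indep.
split.
- by split.
- move=> B [mB intB]; split; first exact: measurableC.
  move: int0; rewrite -(setUv B) integral_setU//.
  + by rewrite intB add0e.
  + exact: measurableC.
  + by rewrite setUv; exact: measurable_int intE.
  + exact/disj_setPCl.
- move=> F tF hF.
  have mF n : measurable (F n) by have [] := hF n.
  have mUF : measurable (\bigcup_n F n) by exact: bigcup_measurable.
  split => //; rewrite integral_bigcup//.
    by rewrite eseries0// => n _ _; have [] := hF n.
  exact: integrableS intE.
Qed.

End filtration_theory.

(** The interval from [- M] to [M] is cut into cells of length [h], and [x] is replaced by the left
    end of its cell. The cell has number [truncn ((x + M) / h)], at most [truncn ((M + M) / h)],
    whence the successor in the number of cells. *)
Lemma step_approximation (R : realType) (M h : R) : 0 < h ->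
  exists (L : nat) (c : 'I_L -> R) (B : 'I_L -> set R),
    (forall a, measurable (B a)) /\
    forall x, `|x| < M -> `|x - \sum_(a < L) c a * \1_(B a) x| <= h.
Proof.
move=> h0; pose t x := (x + M) / h.
pose c a := a%:R * h - M : R.
exists (Num.truncn ((M + M) / h)).+1, (fun a => c a).
exists (fun a => `[c a, c a.+1[%classic); split; first by [].
move=> x; rewrite ltr_norml => /andP[Mx xM].
have t0 : 0 <= (x + M) / h by rewrite divr_ge0 ?(ltW h0)//; lra.
have cP a : (x \in `[c a, c a.+1[) = (Num.truncn ((x + M) / h) == a).
  rewrite truncn_eq// in_itv/= /c lerBlDr ltrBrDr.
  by rewrite ler_pdivlMr// ltr_pdivrMr.
have hL : (Num.truncn ((x + M) / h) < (Num.truncn ((M + M) / h)).+1)%N.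
  by rewrite ltnS le_truncn// ler_pM2r ?invr_gt0//; lra.
rewrite (bigD1 (Ordinal hL))//= big1 ?addr0; last first.
  move=> a /eqP/val_eqP/= aL; rewrite indicE mem_setE cP eq_sym.
  by rewrite (negbTE aL) mulr0.
rewrite indicE mem_setE cP eqxx mulr1.
have := cP (Num.truncn ((x + M) / h)); rewrite eqxx in_itv/= /c => /andP[].
by rewrite -natr1 ler_norml => ? ?; apply/andP; split; lra.
Qed.

Section noise_orthogonality.
Context (R : realType) (d : measure_display) (T : measurableType d)
  (P : probability T R).

Lemma ae_bounded_integrableM (f g : T -> R) (M : R) :
  measurable_fun setT f -> {ae P, forall w, `|f w| < M} ->
  P.-integrable setT (EFin \o g) ->
  P.-integrable setT (fun w => (f w * g w)%:E).
Proof.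
move=> mf fM intg; have mg : measurable_fun setT g.
  by apply/measurable_EFinP; exact: measurable_int intg.
apply/integrableP; split.
  by apply/measurable_EFinP; exact: measurable_funM.
apply: (@le_lt_trans _ _ (\int[P]_w (`|M|%:E * `|(g w)%:E|))%E).
  apply: ae_ge0_le_integral => //.
  - apply: measurableT_comp => //; apply/measurable_EFinP.
    exact: measurable_funM.
  - apply: measurable_funeM; apply: measurableT_comp => //.
    exact/measurable_EFinP.
  move: fM; apply: filterS => w fM _; rewrite /= lee_fin normrM ler_wpM2r//.
  by rewrite (le_trans (ltW fM))// ler_norm.
rewrite ge0_integralZl//.
  by rewrite lte_mul_pinfty//; case/integrableP : intg.
by apply: measurableT_comp => //; exact/measurable_EFinP.
Qed.

Variables (N : nat) (sigma : 'I_N -> R) (eps : 'I_N -> {RV P >-> R}).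
Hypothesis heps : gaussian_noises sigma eps.

Lemma integral_eps_indic (k : 'I_N) (A : set T) : filtration eps k A ->
  (\int[P]_w (eps k w * \1_A w)%:E = 0)%E.
Proof.
move=> FA; rewrite -[RHS](integral_eps_filtration heps FA) [RHS]integral_mkcond.
apply: eq_integral => w _; rewrite patchE indicE.
by case: ifP => _; rewrite ?mulr1 ?mulr0.
Qed.

Lemma integrable_eps_indic (k : 'I_N) (A : set T) : measurable A ->
  P.-integrable setT (fun w => (eps k w * \1_A w)%:E).
Proof.
move=> mA; under eq_fun do rewrite mulrC.
apply: (@ae_bounded_integrableM _ _ 2); last exact: integrable_eps heps _.
- exact: measurable_indic.
- apply: aeW => w; rewrite indicE ger0_norm ?ler0n//.
  by case: (_ \in _); rewrite ?ltr1n ?ltr0n.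
Qed.

(** A step function of [z] is a combination of indicators of past events, each orthogonal to
    [eps k]. Approximating [z] uniformly within [h] bounds the integral by [h] times the mean of
    [|eps k|], for every [h > 0]. *)
Lemma integral_eps_mul (k : 'I_N) (z : T -> R) (M : R) :
  measurable_wrt (filtration eps k) z -> {ae P, forall w, `|z w| < M} ->
  (\int[P]_w (z w * eps k w)%:E = 0)%E.
Proof.
move=> Fz zM; have mz := measurable_wrt_measurable_fun Fz.
have inteps := integrable_eps heps k.
have intze := ae_bounded_integrableM mz zM inteps.
have abs_lt : (\int[P]_w `|(eps k w)%:E| < +oo)%E by case/integrableP: inteps.
have finabs : (\int[P]_w `|(eps k w)%:E|)%E \is a fin_num.
  by rewrite ge0_fin_numE// integral_ge0.
suff bnd (h : R) : 0 < h ->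
    (`|\int[P]_w (z w * eps k w)%:E| <= h%:E * \int[P]_w `|(eps k w)%:E|)%E.
  have finI := integrable_fin_num measurableT intze.
  rewrite -(fineK finI); congr (_%:E); apply/eqP.
  rewrite -normr_eq0 eq_le normr_ge0 andbT; apply/ler_addgt0Pl => e e0.
  rewrite addr0; set E := fine (\int[P]_w `|(eps k w)%:E|)%E.
  have E0 : 0 <= E by apply: fine_ge0; exact: integral_ge0.
  (* The denominator [E + 1] stays positive when the noise is degenerate and [E = 0]. *)
  have h0 : 0 < e / (E + 1) by rewrite divr_gt0// ltr_wpDl.
  have := bnd _ h0; rewrite -(fineK finI) -(fineK finabs) -EFinM lee_fin.
  move=> /le_trans; apply; rewrite mulrAC ler_pdivrMr ?ltr_wpDl//.
  by rewrite ler_pM2l// lerDl.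
move=> h0; have [L [c [B [mB approx]]]] := step_approximation M h0.
pose A a := z @^-1` B a.
have FA a : filtration eps k (A a) by exact: Fz.
have mA a : measurable (A a) by exact: filtration_sub_measurable (FA a).
pose s w := \sum_(a < L) c a * (eps k w * \1_(A a) w).
have inta a : P.-integrable setT (fun w => (c a * (eps k w * \1_(A a) w))%:E).
  under eq_fun do rewrite EFinM.
  by apply: integrableZl => //; exact: integrable_eps_indic.
have sE : (fun w => (s w)%:E) =
    (fun w => \sum_(a < L) (c a * (eps k w * \1_(A a) w))%:E)%E.
  by apply/funext => w; rewrite sumEFin.
have ints : P.-integrable setT (fun w => (s w)%:E).
  by rewrite sE; apply: integrable_sum => // a _; exact: inta.
have ints0 : (\int[P]_w (s w)%:E = 0)%E.
  rewrite sE integral_sum//; apply: big1 => a _.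
  under eq_integral do rewrite EFinM.
  rewrite integralZl//; first by rewrite integral_eps_indic// mule0.
  exact: integrable_eps_indic.
have -> : (\int[P]_w (z w * eps k w)%:E = \int[P]_w (z w * eps k w - s w)%:E)%E.
  under [RHS]eq_integral do rewrite EFinB.
  by rewrite integralB// ints0 sube0.
have ms : measurable_fun setT s by apply/measurable_EFinP; exact: measurable_int ints.
have mze : measurable_fun setT (fun w => z w * eps k w).
  exact: measurable_funM.
have mdiff : measurable_fun setT (fun w => (z w * eps k w - s w)%:E).
  by apply/measurable_EFinP; exact: measurable_funB.
apply: le_trans (le_abse_integral _ _ _) _ => //.
rewrite -ge0_integralZl//; last 2 first.
- by apply: measurableT_comp => //; exact/measurable_EFinP.
- by rewrite lee_fin ltW.
apply: ae_ge0_le_integral => //.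
- exact: measurableT_comp.
- by move=> w _; rewrite mule_ge0// lee_fin ltW.
- apply: measurable_funeM; apply: measurableT_comp => //.
  exact/measurable_EFinP.
(* The approximation is valid only where [|z w| < M], hence an almost sure comparison. *)
move: zM; apply: filterS => w /approx zw _; rewrite /= lee_fin.
have -> : z w * eps k w - s w =
    (z w - \sum_(a < L) c a * \1_(B a) (z w)) * eps k w.
  rewrite mulrBl mulr_suml; congr (_ - _); apply: eq_bigr => a _.
  rewrite !indicE (_ : (w \in A a) = (z w \in B a)); first by ring.
  by apply/idP/idP; rewrite !inE.
by rewrite normrM ler_wpM2r.
Qed.

End noise_orthogonality.

(** * The expected cost *)

(** Vectors are functions on ['I_N], so that a strategy at the outcome [w] is simply [xi^~ w]. *)
Definition bform (R : pzRingType) (N : nat) (A : 'M[R]_N) (x y : 'I_N -> R) : R :=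
  \sum_i \sum_j A i j * (x i * y j).

Lemma ord_minE (N : nat) (i j : 'I_N) :
  Order.min i j = if (i < j)%N then i else j.
Proof. by rewrite minEle leEord; case: ltngtP => // /val_inj. Qed.

Section execution_cost.
Context (R : realType) (N : nat) (theta eta : 'rV[R]_N).

(** The entries [(i, j)] and [(j, i)] both carry [theta] at the earlier date, so half the form
    counts each pair once: this is the impact part of the cost. *)
Lemma half_bform_impact (x : 'I_N -> R) :
  2^-1 * bform (impact_matrix theta eta) x x =
  \sum_i (eta 0 i * x i ^+ 2 +
          \sum_(j < N | (j < i)%N) theta 0 j * x j * x i).
Proof.
pose low (i j : 'I_N) := if (j < i)%N then theta 0 j * x j * x i else 0.
have E (i j : 'I_N) : impact_matrix theta eta i j * (x i * x j) =
    (if i == j then 2 * (eta 0 i * x i ^+ 2) else 0) + low i j + low j i.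
  rewrite mxE ord_minE /low -val_eqE /=; case: (ltngtP i j) => ij //=.
  - by ring.
  - by ring.
  - by rewrite (val_inj ij); ring.
rewrite /bform; under eq_bigr do under eq_bigr do rewrite E.
under eq_bigr do rewrite 2!big_split /=.
rewrite 2!big_split /= [X in _ + _ + X]exchange_big /=.
have -> : \sum_i \sum_j (if i == j then 2 * (eta 0 i * x i ^+ 2) else 0) =
    2 * \sum_i eta 0 i * x i ^+ 2.
  rewrite mulr_sumr; apply: eq_bigr => i _.
  rewrite (bigD1 i)//= eqxx big1 ?addr0// => j /negbTE.
  by rewrite eq_sym => ->.
have -> : \sum_i \sum_j low i j =
    \sum_(i < N) \sum_(j < N | (j < i)%N) theta 0 j * x j * x i.
  by apply: eq_bigr => i _; rewrite [RHS]big_mkcond.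
by rewrite big_split /=; field.
Qed.

Lemma market_priceE (T : Type) (S0 : R) (eps xi : 'I_N -> T -> R) (k : nat) w :
  (k <= N)%N ->
  market_price S0 theta eps xi k w =
  S0 + \sum_(j < N | (j < k)%N) (theta 0 j * xi j w + eps j w).
Proof.
elim: k => [|k IH] kN; first by rewrite /= big_pred0 ?addr0.
rewrite /= IH 1?ltnW// -addrA; congr (_ + _).
rewrite insubT [RHS](bigD1 (Ordinal kN))//= addrC; congr (_ + _).
apply: eq_bigl => j; rewrite -val_eqE /= ltnS.
by case: ltngtP.
Qed.

Lemma execution_costE (T : Type) (S0 Q : R) (eps xi : 'I_N -> T -> R) w :
  \sum_i xi i w = - Q ->
  Q * S0 + \sum_(i < N) xi i w * execution_price S0 theta eta eps xi i w =
  2^-1 * bform (impact_matrix theta eta) (xi^~ w) (xi^~ w) -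
  (Q * \sum_j eps j w + \sum_(j < N) \sum_(i < N | (i <= j)%N) xi i w * eps j w).
Proof.
move=> sumxi; rewrite half_bform_impact.
have E i : xi i w * execution_price S0 theta eta eps xi i w =
    S0 * xi i w + (eta 0 i * xi i w ^+ 2 +
      \sum_(j < N | (j < i)%N) theta 0 j * xi j w * xi i w) +
    \sum_(j < N | (j < i)%N) xi i w * eps j w.
  rewrite /execution_price market_priceE 1?ltnW// big_split /=.
  by rewrite -mulr_suml -mulr_sumr; ring.
under eq_bigr do rewrite E.
rewrite 2!big_split /= -mulr_sumr sumxi.
(* Trades with [j < i] may depend on [eps j]. By the constraint their sum is [- Q] minus the sum of
   those with [i <= j], which are decided before [eps j] is revealed. *)
have -> : \sum_(i < N) \sum_(j < N | (j < i)%N) xi i w * eps j w =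
   - (Q * \sum_j eps j w + \sum_(j < N) \sum_(i < N | (i <= j)%N) xi i w * eps j w).
  apply/eqP; rewrite -addr_eq0 addrCA; apply/eqP.
  rewrite (exchange_big_dep xpredT)//= -big_split /=.
  under [X in _ + X]eq_bigr => j _.
    rewrite (_ : _ + _ = \sum_i xi i w * eps j w); last first.
      rewrite [RHS](bigID (fun i : 'I_N => (j < i)%N))/=; congr (_ + _).
      by apply: eq_bigl => i; rewrite -leqNgt.
    rewrite -mulr_suml sumxi; over.
  by rewrite -mulr_sumr; ring.
by ring.
Qed.

End execution_cost.

Section expected_cost_theory.
Context (R : realType) (d : measure_display) (T : measurableType d)
  (P : probability T R) (N : nat) (sigma : 'I_N -> R)
  (eps : 'I_N -> {RV P >-> R}).
Hypothesis heps : gaussian_noises sigma eps.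

Lemma integral_probability_cst (c : R) : (\int[P]_w c%:E = c%:E)%E.
Proof.
by rewrite -[RHS]mule1 -(probability_setT P); exact: integral_cst.
Qed.

(** Every version is constant, since its preimages are empty or full; so the equality holds at every
    [w], not only almost surely. *)
Lemma cond_expectation_trivial (X : T -> R) (w : T) :
  P.-integrable setT (EFin \o X) ->
  (cond_expectation P (filtration eps 0) X w)%:E = (\int[P]_w (X w)%:E)%E.
Proof.
move=> intX; have finX := integrable_fin_num measurableT intX.
set Y := cond_expectation _ _ _.
have [mY _ intY] : is_cond_expectation P (filtration eps 0) X Y.
  (* The constant equal to the mean is a version, so [xget] does not fall back on its default. *)
  suff /(xgetI (fun=> 0)) : [set Y | is_cond_expectation P (filtration eps 0) X Y]
    (cst (fine (\int[P]_w (X w)%:E)%E)) by [].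
  split.
  - exact: measurable_wrt_cst.
  - exact: finite_measure_integrable_cst.
  - move=> B /filtration0 [->|->]; first by rewrite !integral_set0.
    by rewrite integral_probability_cst fineK.
have Ycst v : Y v = Y w.
  have [|FT] := filtration0 (mY _ (measurable_set1 (Y w))).
    by move=> /seteqP[/(_ w)/=]; case.
  by have : setT v by []; rewrite -FT.
have FT : filtration eps 0 setT.
  have := @measurable_wrt_cst _ _ _ _ _ eps 0 0 setT measurableT.
  by rewrite preimage_setT.
rewrite -intY//; under eq_integral do rewrite Ycst.
by rewrite integral_probability_cst.
Qed.

Lemma ae_eq_integrable (X Y : T -> \bar R) : measurable_fun setT X ->
  ae_eq P setT X Y -> P.-integrable setT Y -> P.-integrable setT X.
Proof.
move=> mX XY /integrableP[mY Yoo]; apply/integrableP; split => //.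
rewrite (ge0_ae_eq_integral _ _ _ _ _ (g := fun w => `|Y w|%E))//.
- exact: measurableT_comp.
- exact: measurableT_comp.
- by move: XY; apply: filterS => w XY ?; rewrite XY.
Qed.

Lemma ae_bounded_integrable (f : T -> R) (M : R) :
  measurable_fun setT f -> {ae P, forall w, `|f w| < M} ->
  P.-integrable setT (EFin \o f).
Proof.
move=> mf fM.
have := ae_bounded_integrableM mf fM (finite_measure_integrable_cst P 1 measurableT).
by under eq_fun do rewrite mulr1.
Qed.

Lemma integrable_bform (A : 'M[R]_N) (x y : 'I_N -> T -> R) (M : R) :
  (forall i, measurable_fun setT (x i)) -> (forall i, measurable_fun setT (y i)) ->
  (forall i, {ae P, forall w, `|x i w| < M}) ->
  (forall i, {ae P, forall w, `|y i w| < M}) ->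
  P.-integrable setT (fun w => (bform A (x^~ w) (y^~ w))%:E).
Proof.
move=> mx my xM yM.
have -> : (fun w => (bform A (x^~ w) (y^~ w))%:E) =
    (fun w => \sum_i \sum_j (A i j)%:E * (x i w * y j w)%:E)%E.
  apply/funext => w; rewrite -sumEFin; apply: eq_bigr => i _.
  by rewrite -sumEFin.
apply: integrable_sum => // i _; apply: integrable_sum => // j _.
apply: integrableZl => //; apply: ae_bounded_integrableM (xM i) _ => //.
exact: ae_bounded_integrable (yM j).
Qed.

Lemma expected_costE (S0 Q : R) (theta eta : 'rV[R]_N) (xi : 'I_N -> T -> R) (w : T) :
  admissible eps Q xi ->
  (expected_cost S0 eps Q theta eta xi w)%:E =
  (\int[P]_w (2^-1 * bform (impact_matrix theta eta) (xi^~ w) (xi^~ w))%:E)%E.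
Proof.
move=> [Fxi sumxi [M M0 xiM]].
have mxi i : measurable_fun setT (xi i) by exact: measurable_wrt_measurable_fun (Fxi i).
have inteps := integrable_eps heps.
set A := impact_matrix theta eta.
pose q w := 2^-1 * bform A (xi^~ w) (xi^~ w).
pose noise w := Q * \sum_j eps j w +
  \sum_(j < N) \sum_(i < N | (i <= j)%N) xi i w * eps j w.
have intq : P.-integrable setT (EFin \o q).
  rewrite (_ : _ \o _ = (fun w => 2^-1%:E * (bform A (xi^~ w) (xi^~ w))%:E)%E)//.
  by apply: integrableZl => //; exact: (integrable_bform A mxi mxi xiM xiM).
have intxe i j : P.-integrable setT (fun w => (xi i w * eps j w)%:E).
  exact: ae_bounded_integrableM (xiM i) (inteps j).
have noiseE : EFin \o noise = (fun w => Q%:E * (\sum_j (eps j w)%:E) +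
    \sum_(j < N) \sum_(i < N | (i <= j)%N) (xi i w * eps j w)%:E)%E.
  apply/funext => v; rewrite /= EFinD EFinM -!sumEFin; congr (_ + _)%E.
  by apply: eq_bigr => j _; rewrite -sumEFin.
have intsum : P.-integrable setT (fun w => \sum_j (eps j w)%:E)%E.
  by apply: integrable_sum => // j _; exact: inteps.
have intdbl : P.-integrable setT (fun w =>
    \sum_(j < N) \sum_(i < N | (i <= j)%N) (xi i w * eps j w)%:E)%E.
  by apply: integrable_sum => // j _; apply: integrable_sum.
have intnoise : P.-integrable setT (EFin \o noise).
  by rewrite noiseE; apply: integrableD => //; exact: integrableZl.
have noise0 : (\int[P]_w (noise w)%:E = 0)%E.
  rewrite -[LHS]/(\int[P]_w (EFin \o noise) w)%E noiseE integralD//; last first.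
    exact: integrableZl.
  have -> : (\int[P]_w (Q%:E * (\sum_j (eps j w)%:E)) = 0)%E.
    rewrite integralZl// integral_sum//.
    rewrite big1 ?mule0// => j _.
    by apply: (integral_eps_indep heps) => // B mB; rewrite setTI probability_setT mul1e.
  rewrite add0e integral_sum//; last by move=> j; apply: integrable_sum.
  apply: big1 => j _; rewrite integral_sum//; apply: big1 => i ij.
  (* As [i <= j], the trade [xi i] is measurable with respect to [filtration eps j]. *)
  apply: (integral_eps_mul heps (M := M)); last exact: xiM.
  by move=> B mB; apply: filtration_le ij _ _; exact: Fxi.
have mX : measurable_fun setT (fun w => Q * S0 +
    \sum_(i < N) xi i w * execution_price S0 theta eta eps xi i w).
  apply: measurable_funD => //; apply: measurable_sum => i.
  apply: measurable_funM => //; apply: measurable_funD; last exact: measurable_funM.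
  rewrite (_ : market_price _ _ _ _ _ = fun w => S0 +
      \sum_(j < N | (j < i)%N) (theta 0 j * xi j w + eps j w)); last first.
    by apply/funext => v; rewrite market_priceE// ltnW.
  apply: measurable_funD => //.
  under eq_fun do rewrite big_mkcond /=.
  apply: measurable_sum => j; case: (j < i)%N => //.
  by apply: measurable_funD => //; exact: measurable_funM.
(* The constraint holds almost surely, and so does the decomposition of the cost. *)
have XE : ae_eq P setT (fun w => (Q * S0 +
    \sum_(i < N) xi i w * execution_price S0 theta eta eps xi i w)%:E)
    (fun w => (q w - noise w)%:E).
  by move: sumxi; apply: filterS => v sumv _; congr (_%:E); exact: execution_costE.
have intd : P.-integrable setT (fun w => (q w - noise w)%:E).
  by under eq_fun do rewrite EFinB; exact: integrableB.
rewrite /expected_cost cond_expectation_trivial; last first.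
  by apply: ae_eq_integrable XE intd => //; exact/measurable_EFinP.
transitivity (\int[P]_w (q w - noise w)%:E)%E.
  apply: ae_eq_integral => //; first exact/measurable_EFinP.
  exact: measurable_int intd.
under eq_integral do rewrite EFinB.
by rewrite integralB// noise0 sube0.
Qed.

End expected_cost_theory.

(** * Symmetric B-matrices *)

Section bilinear_form.
Context (R : comPzRingType) (N : nat).
Implicit Types (A : 'M[R]_N) (x y z : 'I_N -> R).

Lemma bformE A x y : bform A x y = \sum_i x i * \sum_j A i j * y j.
Proof.
apply: eq_bigr => i _; rewrite mulr_sumr; apply: eq_bigr => j _.
by rewrite mulrCA.
Qed.

Lemma bform_sym A x y : (forall i j, A i j = A j i) -> bform A x y = bform A y x.
Proof.
move=> symA; rewrite /bform exchange_big; apply: eq_bigr => i _.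
by apply: eq_bigr => j _; rewrite symA (mulrC (x j)).
Qed.

Lemma bform_shift A x y (a : R) : (forall i j, A i j = A j i) ->
  bform A (fun i => x i + a * y i) (fun i => x i + a * y i) =
  bform A x x + a * 2%:R * bform A y x + a ^+ 2 * bform A y y.
Proof.
move=> symA.
have -> : a * 2%:R * bform A y x = a * (bform A y x + bform A x y).
  by rewrite (bform_sym x)//; ring.
rewrite mulrDr /bform !mulr_sumr -!big_split /=; apply: eq_bigr => i _.
rewrite !mulr_sumr -!big_split /=; apply: eq_bigr => j _.
by ring.
Qed.

End bilinear_form.

Section B_matrix_theory.
Context (R : realFieldType) (N : nat).
Implicit Types (A : 'M[R]_N) (x y : 'I_N -> R).

(** Suppose both alternatives fail, and sum the columns of [D] over the set [S] of negative entries
    of [y]. Row [i] of the result is positive for [i] in [S], because rows of [D] sum to zero and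
    the complement of [S] is not empty, and it is at most zero otherwise. Weighting by [y] gives a
    negative number, whereas [y^T D = 0] makes it zero. *)
Lemma B_matrix_same_sign A y (c : R) : B_matrix A ->
  (forall j, \sum_i y i * A i j = c) ->
  (forall i, 0 <= y i) \/ (forall i, y i < 0).
Proof.
move=> hA yA; have [|/existsNP[i0 /negP]] := pselect (forall i, 0 <= y i).
  by left.
rewrite -ltNge => yi0.
have [|/existsNP[i1 /negP]] := pselect (forall i, y i < 0); first by right.
rewrite -leNgt => yi1.
have N0 : N%:R != 0 :> R by rewrite pnatr_eq0 -lt0n (leq_ltn_trans _ (ltn_ord i0)).
pose r i := \sum_k A i k.
pose D i j := A i j - N%:R^-1 * r i.
have D0 i : \sum_j D i j = 0.
  rewrite sumrB sumr_const card_ord -mulrnAl -[_ *+ N]mulr_natr mulVf// mul1r.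
  by rewrite subrr.
have Dlt0 i j : j != i -> D i j < 0 by rewrite subr_lt0; apply: (hA i).2.
(* Summing the equations [y^T A = c 1^T] over the columns; this is what turns [y] into a left null
   vector of [D]. *)
have yr : \sum_i y i * r i = N%:R * c.
  under eq_bigr do rewrite mulr_sumr.
  rewrite exchange_big /=; under eq_bigr do rewrite yA.
  by rewrite sumr_const card_ord mulr_natl.
have yD j : \sum_i y i * D i j = 0.
  under eq_bigr do rewrite mulrBr mulrCA.
  by rewrite sumrB yA -mulr_sumr yr mulKf// subrr.
pose S i := y i < 0.
have : \sum_i y i * \sum_(j | S j) D i j = 0.
  under eq_bigr do rewrite mulr_sumr.
  by rewrite exchange_big /= big1.
have SD i : S i -> 0 < \sum_(j | S j) D i j.
  move=> Si; have := D0 i; rewrite (bigID S)/= => /eqP.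
  rewrite addr_eq0 => /eqP ->; rewrite oppr_gt0.
  have nS1 : ~~ S i1 by rewrite -leNgt.
  rewrite (bigD1 i1)//= ltr_nwDl//.
    by apply: Dlt0; apply: contraNneq nS1 => ->.
  apply: sumr_le0 => j /andP[nSj _]; apply/ltW/Dlt0.
  by apply: contraNneq nSj => ->.
have nSD i : ~~ S i -> \sum_(j | S j) D i j <= 0.
  move=> nSi; apply: sumr_le0 => j Sj; apply/ltW/Dlt0.
  by apply: contraNneq nSi => <-.
suff : \sum_i y i * \sum_(j | S j) D i j < 0 by move=> + E; rewrite E ltxx.
rewrite (bigD1 i0)//= ltr_nwDl//.
  by rewrite nmulr_rlt0// SD.
apply: sumr_le0 => i _; have [Si|nSi] := boolP (S i).
  by rewrite nmulr_rle0// ltW// SD.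
by rewrite mulr_ge0_le0// ?nSD//; rewrite leNgt.
Qed.

(** By symmetry [x] is a left null vector, hence of one sign; it is also orthogonal to the row sums,
    which are all positive. *)
Lemma B_matrix_inj A x : B_matrix A -> (forall i j, A i j = A j i) ->
  (forall i, \sum_j A i j * x j = 0) -> forall i, x i = 0.
Proof.
move=> hA symA Ax i.
have xA j : \sum_i x i * A i j = 0.
  by rewrite -[RHS](Ax j); apply: eq_bigr => k _; rewrite symA mulrC.
have xr : \sum_i x i * \sum_k A i k = 0.
  under eq_bigr do rewrite mulr_sumr.
  by rewrite exchange_big /= big1.
have [x0|x0] := B_matrix_same_sign hA xA.
  have xr0 j : true -> 0 <= x j * \sum_k A j k.
    by move=> _; rewrite mulr_ge0// ltW// (hA j).1.
  have /(_ i isT)/eqP := psumr_eq0P xr0 xr.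
  by rewrite mulf_eq0 (gt_eqF (hA i).1) orbF => /eqP.
suff : \sum_i x i * \sum_k A i k < 0 by rewrite xr ltxx.
rewrite (bigD1 i)//= ltr_nwDl//.
  by rewrite pmulr_llt0 ?x0// (hA i).1.
by apply: sumr_le0 => j _; rewrite pmulr_lle0 ?(hA j).1// ltW.
Qed.

(** The off-diagonal entries are unchanged while each row mean grows by [t / N]. *)
Lemma B_matrix_shift A (t : R) : 0 <= t -> B_matrix A -> B_matrix (A + t%:M).
Proof.
move=> t0 hA i.
have E : \sum_k (A + t%:M) i k = \sum_k A i k + t.
  under eq_bigr do rewrite !mxE.
  rewrite big_split /=; congr (_ + _).
  by rewrite (bigD1 i)//= eqxx big1 ?addr0// => k /negbTE; rewrite eq_sym => ->.
split; first by rewrite E ltr_pwDl// (hA i).1.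
move=> j ji; rewrite E !mxE eq_sym (negbTE ji) addr0 mulrDr.
by rewrite (lt_le_trans ((hA i).2 j ji))// lerDl mulr_ge0// invr_ge0.
Qed.

End B_matrix_theory.

(** From a zero [x] of the form, a small step against [g = A x] would make the form negative unless
    [g = 0]. *)
Lemma bform_psd_null (R : realFieldType) (N : nat) (A : 'M[R]_N) (x : 'I_N -> R) :
  (forall i j, A i j = A j i) -> (forall y, 0 <= bform A y y) ->
  bform A x x = 0 -> forall i, \sum_j A i j * x j = 0.
Proof.
move=> symA psd x0.
pose g i := \sum_j A i j * x j.
pose s := \sum_i g i ^+ 2.
have s0 : 0 <= s by apply: sumr_ge0 => i _; exact: sqr_ge0.
suff /eqP : s = 0.
  rewrite psumr_eq0 => [/allP g0 i|i _]; last exact: sqr_ge0.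
  by have := g0 i (mem_index_enum i); rewrite sqrf_eq0 => /eqP.
have gx : bform A g x = s by rewrite bformE.
have b0 := psd g; set b := bform A g g in b0.
apply/eqP; rewrite eq_le s0 andbT.
have b1 : 0 < b + 1 by rewrite ltr_wpDl.
(* The step length [s / (b + 1)], defined even for [b = 0], gives the value
   [- s^2 (b + 2) / (b + 1)^2]. *)
have := psd (fun i => x i + (- (s / (b + 1))) * g i).
rewrite bform_shift// x0 gx -/b => H.
have {}H : 0 <= (s ^+ 2 / (b + 1) ^+ 2) * (- (b + 2)).
  apply: (le_trans H); rewrite le_eqVlt; apply/orP; left; apply/eqP.
  by field; rewrite gt_eqF.
rewrite leNgt; apply/negP => sp; move: H; apply/negP; rewrite -ltNge.
by rewrite pmulr_rlt0 ?divr_gt0 ?exprn_gt0//; lra.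
Qed.

(** * Continuity of the determinant and of the adjugate *)

Lemma cvg_sum (R : realType) (V : Type) (F : set_system V) {FF : Filter F}
  (I : Type) (s : seq I) (Q : pred I) (f : I -> V -> R) (l : I -> R) :
  (forall i, f i u @[u --> F] --> l i) ->
  (\sum_(i <- s | Q i) f i u) @[u --> F] --> \sum_(i <- s | Q i) l i.
Proof.
by move=> cf; apply: cvg_big => //; exact: add_continuous.
Qed.

Lemma cvg_prod (R : realType) (V : Type) (F : set_system V) {FF : Filter F}
  (I : Type) (s : seq I) (Q : pred I) (f : I -> V -> R) (l : I -> R) :
  (forall i, f i u @[u --> F] --> l i) ->
  (\prod_(i <- s | Q i) f i u) @[u --> F] --> \prod_(i <- s | Q i) l i.
Proof.
by move=> cf; apply: cvg_big => //; exact: mul_continuous.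
Qed.

Lemma cvg_det (R : realType) (V : Type) (F : set_system V) {FF : Filter F}
  (n : nat) (f : V -> 'M[R]_n) (A : 'M[R]_n) :
  (forall i j, f u i j @[u --> F] --> A i j) ->
  \det (f u) @[u --> F] --> \det A.
Proof.
move=> cf; apply: cvg_sum => s; apply: cvgM; first exact: cvg_cst.
by apply: cvg_prod => i; exact: cf.
Qed.

Lemma cvg_adjugate (R : realType) (V : Type) (F : set_system V) {FF : Filter F}
  (n : nat) (f : V -> 'M[R]_n) (A : 'M[R]_n) (i j : 'I_n) :
  (forall i j, f u i j @[u --> F] --> A i j) ->
  (\adj (f u)) i j @[u --> F] --> (\adj A) i j.
Proof.
move=> cf; rewrite mxE; under eq_fun do rewrite mxE.
apply: cvgM; first exact: cvg_cst.
by apply: cvg_det => k l; rewrite !mxE; under eq_fun do rewrite !mxE; exact: cf.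
Qed.

(** * Positive definiteness and the constrained minimizer *)

Section positive_definite.
Context (R : realType) (N : nat).
Implicit Types (A : 'M[R]_N) (x : 'I_N -> R).

Lemma bform_sqrsum A (m : R) x :
  bform (A + (- m)%:M) x x = bform A x x - m * \sum_i x i ^+ 2.
Proof.
rewrite !bformE mulr_sumr -sumrB; apply: eq_bigr => i _.
under eq_bigr do rewrite !mxE mulrDl.
rewrite big_split /= mulrDr; congr (_ + _).
rewrite (bigD1 i)//= eqxx big1 ?addr0 => [|j /negbTE]; first by rewrite mulr1n; ring.
by rewrite eq_sym => ->; rewrite mulr0n mul0r.
Qed.

Lemma bform_scale A (a : R) x :
  bform A (fun i => a * x i) (fun i => a * x i) = a ^+ 2 * bform A x x.
Proof.
rewrite /bform mulr_sumr; apply: eq_bigr => i _; rewrite mulr_sumr.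
by apply: eq_bigr => j _; ring.
Qed.

(** For symmetric [A], [m] is the least eigenvalue and [c] an eigenvector: the form attains its
    minimum on the unit sphere, which is compact, and nonempty thanks to [x0]. *)
Lemma bform_min A x0 : (exists i, x0 i != 0) ->
  exists (m : R) c, [/\ (exists i, c i != 0), bform A c c = m * \sum_i c i ^+ 2 &
    forall x, m * \sum_i x i ^+ 2 <= bform A x x].
Proof.
move=> [k xk0].
have sq_gt0 (x : 'I_N -> R) i : x i != 0 -> 0 < \sum_i x i ^+ 2.
  move=> xi; rewrite (bigD1 i)//= ltr_pwDl ?exprn_even_gt0//=.
  by apply: sumr_ge0 => j _; exact: sqr_ge0.
pose S := [set v : 'rV[R]_N | \sum_i v 0 i ^+ 2 = 1].
pose f (v : 'rV[R]_N) := bform A (v 0) (v 0).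
pose unit x : 'rV[R]_N := \row_i ((Num.sqrt (\sum_i x i ^+ 2))^-1 * x i).
have unitS x i : x i != 0 -> S (unit x).
  move=> xi; rewrite /S /=; under eq_bigr do rewrite mxE exprMn exprVn.
  rewrite -mulr_sumr sqr_sqrtr; last exact/ltW/(sq_gt0 _ i).
  by rewrite mulVf// gt_eqF// (sq_gt0 _ i).
have ccoord i : continuous (fun v : 'rV[R]_N => v 0 i) by exact: coord_continuous.
have cf : continuous f.
  move=> v; rewrite /continuous_at.
  apply: (@cvg_sum _ _ (nbhs v)) => i; apply: (@cvg_sum _ _ (nbhs v)) => j.
  by apply: cvgM; [exact: cvg_cst|apply: cvgM; exact: ccoord].
have cS : compact S.
  apply: bounded_closed_compact.
    exists 1; split => // M M1 v /= vS.
    rewrite /Num.norm/= mx_normrE; apply/bigmax_leP; split; first lra.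
    move=> [i j] _ /=; rewrite (ord1 i); apply: le_trans (ltW M1).
    rewrite -(@expr_le1 _ 2)// real_normK ?num_real// -vS (bigD1 j)//= lerDl.
    by apply: sumr_ge0 => l _; exact: sqr_ge0.
  rewrite (_ : S = (fun v : 'rV[R]_N => \sum_i v 0 i ^+ 2) @^-1` [set 1])//.
  apply: preimage_closed; last exact: closed_eq.
  by move=> v _; apply: (@cvg_sum _ _ (nbhs v)) => i; apply: cvgM; exact: ccoord.
have S0 : S !=set0 by exists (unit x0); exact: unitS xk0.
have [c cSm cmin] := EVT_min_rV S0 cS (continuous_subspaceT cf).
have {}cSm : \sum_i c 0 i ^+ 2 = 1 by move: cSm; rewrite inE.
exists (f c), (c 0); split.
- apply: contrapT => /forallNP c0; move/eqP: cSm.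
  rewrite big1 ?(eq_sym 0) ?oner_eq0// => i _.
  by have /negP := c0 i; rewrite negbK => /eqP ->; rewrite expr0n.
- by rewrite cSm mulr1.
move=> x; have [[i xi0]|/forallNP x0'] := pselect (exists i, x i != 0).
  have s0 := sq_gt0 _ _ xi0; set s := \sum_i x i ^+ 2 in s0 *.
  (* Homogeneity of degree two carries the bound from the unit vector to [x]. *)
  have := cmin (unit x); rewrite inE => /(_ (unitS _ _ xi0)).
  rewrite (_ : f (unit x) = s^-1 * bform A x x).
    by rewrite ler_pdivlMl// mulrC.
  rewrite -[s in RHS]sqr_sqrtr ?ltW// -exprVn -bform_scale.
  by apply: eq_bigr => a _; apply: eq_bigr => b _; rewrite !mxE.
have x00 i : x i = 0 by have /negP := x0' i; rewrite negbK => /eqP.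
rewrite big1 => [|i _]; last by rewrite x00 expr0n.
rewrite mulr0 /bform big1// => i _; rewrite big1// => j _.
by rewrite x00 mul0r mulr0.
Qed.

(** If the minimum [m] were at most zero, [A - m I] would be a symmetric B-matrix, hence injective;
    but its form is nonnegative and vanishes at [c], so [c] would be a null vector. *)
Lemma B_matrix_pos_def A x : B_matrix A -> (forall i j, A i j = A j i) ->
  (exists i, x i != 0) -> 0 < bform A x x.
Proof.
move=> hA symA x0; have [m [c [[k ck] cm mmin]]] := bform_min A x0.
suff m0 : 0 < m.
  apply: lt_le_trans (mmin x); rewrite mulr_gt0//.
  have [i xi] := x0; rewrite (bigD1 i)//= ltr_pwDl ?exprn_even_gt0//=.
  by apply: sumr_ge0 => j _; exact: sqr_ge0.
rewrite ltNge; apply/negP => m0.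
have symM i j : (A + (- m)%:M) i j = (A + (- m)%:M) j i.
  by rewrite !mxE symA (eq_sym i).
have hM : B_matrix (A + (- m)%:M) by apply: B_matrix_shift => //; rewrite oppr_ge0.
move/negP: ck; apply; apply/eqP; apply: (B_matrix_inj hM symM).
apply: bform_psd_null => //.
- by move=> y; rewrite bform_sqrsum subr_ge0.
- by rewrite bform_sqrsum cm subrr.
Qed.

End positive_definite.

(** This is [- Q A^-1 1 / (1^T A^-1 1)] when [A] is invertible, the determinant cancelling. The
    adjugate makes numerator and denominator polynomial in the data. *)
Definition optimal_trade (R : realType) (N : nat) (A : 'M[R]_N) (Q : R) (i : 'I_N) : R :=
  - Q * (\sum_j (\adj A) i j) / \sum_k \sum_j (\adj A) k j.

Section optimal_trade_theory.
Context (R : realType) (N : nat) (A : 'M[R]_N).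
Hypotheses (N0 : (0 < N)%N) (hA : B_matrix A) (symA : forall i j, A i j = A j i).

Lemma B_matrix_det_neq0 : \det A != 0.
Proof.
apply/det0P => -[v v0 vA]; move/eqP: v0; apply; apply/rowP => i; rewrite mxE.
apply: (B_matrix_inj (x := v 0) hA symA) => j.
move/rowP/(_ j): vA; rewrite !mxE; apply: etrans.
by apply: eq_bigr => k _; rewrite symA mulrC.
Qed.

Lemma mul_sum_adjugate i : \sum_j A i j * \sum_k (\adj A) j k = \det A.
Proof.
have E k : \sum_j A i j * (\adj A) j k = (\det A)%:M i k.
  by rewrite -mul_mx_adj mxE.
under eq_bigr do rewrite mulr_sumr.
rewrite exchange_big /= (bigD1 i)//= [X in _ + X]big1 ?addr0.
  by rewrite E mxE eqxx mulr1n.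
by move=> k /negbTE ki; rewrite E mxE eq_sym ki mulr0n.
Qed.

(** The vector [y = adj A 1] solves [A y = det A 1] and is nonzero because [det A] is; hence
    [y^T A y], which is [det A] times the sum of [y], is positive. *)
Lemma sum_adjugate_neq0 : \sum_k \sum_j (\adj A) k j != 0.
Proof.
set y := fun k => \sum_j (\adj A) k j; rewrite -[X in X != _]/(\sum_k y k).
have Ay i : \sum_j A i j * y j = \det A by exact: mul_sum_adjugate.
have y0 : exists i, y i != 0.
  apply: contrapT => /forallNP y0; have := Ay (Ordinal N0).
  rewrite big1 => [E|j _]; first by have := B_matrix_det_neq0; rewrite -E eqxx.
  by have /negP := y0 j; rewrite negbK => /eqP ->; rewrite mulr0.
have := B_matrix_pos_def hA symA y0; rewrite bformE.
under eq_bigr do rewrite Ay.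
by rewrite -mulr_suml; apply: contraTneq => ->; rewrite mul0r ltxx.
Qed.

Lemma sum_optimal_trade Q : \sum_i optimal_trade A Q i = - Q.
Proof.
by rewrite -mulr_suml -mulr_sumr mulfK// sum_adjugate_neq0.
Qed.

(** The Lagrange condition: the right-hand side does not depend on [i]. *)
Lemma optimal_trade_stationary Q i :
  \sum_j A i j * optimal_trade A Q j =
  - Q * \det A / \sum_k \sum_j (\adj A) k j.
Proof.
rewrite -(mul_sum_adjugate i) mulr_sumr mulr_suml; apply: eq_bigr => j _.
by rewrite /optimal_trade !mulrA; congr (_ * _ / _); rewrite mulrC.
Qed.

(** By stationarity and symmetry the sign lemma applies to the opposite trades. All of them negative
    is excluded, as they sum to [Q >= 0]. *)
Lemma optimal_trade_le0 Q : 0 <= Q -> forall i, optimal_trade A Q i <= 0.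
Proof.
move=> Q0; set c := - Q * \det A / \sum_k \sum_j (\adj A) k j.
have xA j : \sum_i - optimal_trade A Q i * A i j = - c.
  rewrite /c -(optimal_trade_stationary Q j) -sumrN.
  by apply: eq_bigr => i _; rewrite symA mulNr mulrC.
have [x0 i|x0] := B_matrix_same_sign hA xA; first by rewrite -oppr_ge0.
exfalso; suff : \sum_i - optimal_trade A Q i < 0.
  by rewrite sumrN sum_optimal_trade opprK ltNge Q0.
rewrite (bigD1 (Ordinal N0))//= ltr_nwDl//.
by apply: sumr_le0 => i _; exact/ltW.
Qed.

(** The deviation from the optimum sums to zero, so the Lagrange condition kills the cross term. *)
Lemma bform_around_optimum Q (z : 'I_N -> R) : \sum_i z i = - Q ->
  bform A z z = bform A (optimal_trade A Q) (optimal_trade A Q) +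
    bform A (fun i => z i - optimal_trade A Q i) (fun i => z i - optimal_trade A Q i).
Proof.
move=> sz; set x := optimal_trade A Q; set y := fun i => z i - x i.
have cross : bform A y x = 0.
  rewrite bformE; under eq_bigr do rewrite optimal_trade_stationary.
  by rewrite -mulr_suml sumrB sz sum_optimal_trade subrr mul0r.
have := bform_shift x y 1 symA; rewrite cross mulr0 addr0 expr1n mul1r => <-.
by congr bform; apply/funext => i; rewrite mul1r /y addrC subrK.
Qed.

End optimal_trade_theory.

Lemma impact_matrix_sym (R : realFieldType) (N : nat) (theta eta : 'rV[R]_N) i j :
  impact_matrix theta eta i j = impact_matrix theta eta j i.
Proof.
by rewrite !mxE eq_sym minC; case: eqP => // ->.
Qed.

(** * Continuous dependence on the data *)

Section stability.
Context (R : realType) (N : nat).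
Implicit Types theta eta : 'rV[R]_N.

Lemma cvg_impact_matrix theta eta i j :
  impact_matrix D.1 D.2 i j @[D --> (theta, eta)] --> impact_matrix theta eta i j.
Proof.
have c1 k : (D.1 : 'rV[R]_N) 0 k @[D --> (theta, eta)] --> theta 0 k.
  apply: (@cvg_comp _ _ _ fst (fun v : 'rV[R]_N => v 0 k) _ (nbhs theta)).
    exact: cvg_fst.
  exact: coord_continuous.
have c2 k : (D.2 : 'rV[R]_N) 0 k @[D --> (theta, eta)] --> eta 0 k.
  apply: (@cvg_comp _ _ _ snd (fun v : 'rV[R]_N => v 0 k) _ (nbhs eta)).
    exact: cvg_snd.
  exact: coord_continuous.
rewrite mxE; under eq_fun do rewrite mxE.
by case: (i == j); [apply: cvgM; [exact: cvg_cst|exact: c2]|exact: c1].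
Qed.

(** The condition consists of finitely many strict inequalities between continuous functions of the
    data. *)
Lemma near_B_matrix theta eta : B_matrix (impact_matrix theta eta) ->
  \forall D \near (theta, eta), B_matrix (impact_matrix D.1 D.2).
Proof.
move=> hA; have cA := @cvg_impact_matrix theta eta.
have csum i : \sum_k impact_matrix D.1 D.2 i k @[D --> (theta, eta)] -->
    \sum_k impact_matrix theta eta i k.
  by apply: cvg_sum => k; exact: cA.
have offdiag (i j : 'I_N) : \forall D \near (theta, eta), j != i ->
    impact_matrix D.1 D.2 i j < N%:R^-1 * \sum_k impact_matrix D.1 D.2 i k.
  have [ji|_] := boolP (j != i); last by apply: (@nearW _ (nbhs (theta, eta))).
  have cdiff : (N%:R^-1 * \sum_k impact_matrix D.1 D.2 i k - impact_matrix D.1 D.2 i j)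
      @[D --> (theta, eta)] -->
      N%:R^-1 * \sum_k impact_matrix theta eta i k - impact_matrix theta eta i j.
    by apply: cvgB => //; apply: cvgM => //; exact: cvg_cst.
  have d0 : 0 < N%:R^-1 * \sum_k impact_matrix theta eta i k - impact_matrix theta eta i j.
    by rewrite subr_gt0 (hA i).2.
  by apply: filterS (cvgr_gt _ cdiff _ d0) => D; rewrite subr_gt0.
suff rows i : \forall D \near (theta, eta),
    0 < \sum_k impact_matrix D.1 D.2 i k /\ forall j, j != i ->
    impact_matrix D.1 D.2 i j < N%:R^-1 * \sum_k impact_matrix D.1 D.2 i k.
  exact: (@filter_forall _ _ _ _ _ rows).
have row_pos : \forall D \near (theta, eta), 0 < \sum_k impact_matrix D.1 D.2 i k.
  exact: (cvgr_gt _ (csum i) _ (hA i).1).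
by apply: filterS2 row_pos (@filter_forall _ _ _ _ _ (offdiag i)) => D.
Qed.

Lemma cvg_optimal_trade Q theta eta i : (0 < N)%N ->
  B_matrix (impact_matrix theta eta) ->
  optimal_trade (impact_matrix u.2.1 u.2.2) u.1 i @[u --> (Q, (theta, eta))] -->
  optimal_trade (impact_matrix theta eta) Q i.
Proof.
move=> N0 hA.
have cA k l : impact_matrix u.2.1 u.2.2 k l @[u --> (Q, (theta, eta))] -->
    impact_matrix theta eta k l.
  apply: (@cvg_comp _ _ _ snd (fun D => impact_matrix D.1 D.2 k l) _
    (nbhs (theta, eta))); first exact: cvg_snd.
  exact: cvg_impact_matrix.
have cadj k : \sum_l (\adj (impact_matrix u.2.1 u.2.2)) k l
    @[u --> (Q, (theta, eta))] --> \sum_l (\adj (impact_matrix theta eta)) k l.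
  by apply: cvg_sum => l; apply: cvg_adjugate; exact: cA.
apply: cvgM.
  apply: cvgM => //; apply: cvgN; exact: cvg_fst.
apply: cvgV; last by apply: cvg_sum => k; exact: cadj.
by apply: sum_adjugate_neq0 => // k l; exact: impact_matrix_sym.
Qed.

End stability.

(** * The execution problem *)

Section execution_problem.
Context (R : realType) (d : measure_display) (T : measurableType d)
  (P : probability T R) (N : nat) (S0 : R) (sigma : 'I_N -> R)
  (eps : 'I_N -> {RV P >-> R}).
Hypotheses (N0 : (0 < N)%N) (heps : gaussian_noises sigma eps).
Variables (theta eta : 'rV[R]_N).
Hypothesis hA : B_matrix (impact_matrix theta eta).
Variable Q : R.

Let A := impact_matrix theta eta.
Let x : 'I_N -> R := optimal_trade A Q.
Let symA i j : A i j = A j i := impact_matrix_sym theta eta i j.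

Lemma bform_B_matrix_ge0 y : 0 <= bform A y y.
Proof.
have [y0|/forallNP y0] := pselect (exists i, y i != 0).
  exact/ltW/B_matrix_pos_def.
rewrite /bform big1// => i _; rewrite big1// => j _.
by have /negP := y0 i; rewrite negbK => /eqP ->; rewrite mul0r mulr0.
Qed.

Lemma admissible_optimal_trade : admissible eps Q (fun i => cst (x i)).
Proof.
split.
- by move=> i; exact: measurable_wrt_cst.
- by apply: aeW => w; rewrite sum_optimal_trade.
- exists (1 + \sum_i `|x i|) => [|i].
    by rewrite ltr_pwDl// sumr_ge0.
  apply: aeW => w /=; rewrite (bigD1 i)//= addrCA ltrDl ltr_pwDl//.
  exact: sumr_ge0.
Qed.

Lemma integrable_excess z : admissible eps Q z ->
  P.-integrable setT
    (fun v => (2^-1 * bform A (fun i => z i v - x i) (fun i => z i v - x i))%:E).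
Proof.
move=> [Fz _ [M M0 zM]]; have [_ _ [L L0 xL]] := admissible_optimal_trade.
have my i : measurable_fun setT (fun v => z i v - x i).
  by apply: measurable_funB => //; exact: measurable_wrt_measurable_fun (Fz i).
have yM i : {ae P, forall v, `|z i v - x i| < M + L}.
  apply: filterS2 (zM i) (xL i) => v zv xv.
  by rewrite (le_lt_trans (ler_normB _ _))// ltrD.
under eq_fun do rewrite EFinM.
by apply: integrableZl => //; exact: (integrable_bform A my my yM yM).
Qed.

(** Integrating the expansion around the optimum; minimality and uniqueness are both read off the
    last integral. *)
Lemma expected_cost_excess z w : admissible eps Q z ->
  (expected_cost S0 eps Q theta eta z w)%:E =
  ((expected_cost S0 eps Q theta eta (fun i => cst (x i)) w)%:E +
  \int[P]_v (2^-1 * bform A (fun i => z i v - x i) (fun i => z i v - x i))%:E)%E.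
Proof.
move=> adz; have inty := integrable_excess adz.
have [Fz sz [M M0 zM]] := adz.
rewrite (expected_costE heps _ _ _ _ admissible_optimal_trade).
rewrite (expected_costE heps _ _ _ _ adz) -/A.
rewrite -integralD//; last first.
  exact: (finite_measure_integrable_cst P (2^-1 * bform A x x) measurableT).
apply: ae_eq_integral => //.
- have mz i : measurable_fun setT (z i) by exact: measurable_wrt_measurable_fun (Fz i).
  have := integrable_bform A mz mz zM zM => /(measurable_int _)/measurable_EFinP mb.
  by apply/measurable_EFinP; exact: measurable_funM.
- apply: emeasurable_funD; last exact: measurable_int inty.
  exact: (measurable_cst (2^-1 * bform A x x)%:E).
move: sz; apply: filterS => v sv _; rewrite -EFinD -mulrDr.
by rewrite (bform_around_optimum N0 hA symA sv).
Qed.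

Lemma optimal_optimal_trade :
  optimal S0 eps Q theta eta (fun i => cst (x i)).
Proof.
split; first exact: admissible_optimal_trade.
move=> z adz; apply: aeW => w; rewrite -lee_fin (expected_cost_excess w adz).
rewrite leeDl// integral_ge0// => v _.
by rewrite lee_fin mulr_ge0 ?invr_ge0 ?bform_B_matrix_ge0.
Qed.

(** Optimality of [z] makes the integral of the excess at most zero; the excess is nonnegative,
    hence almost surely zero, and positive definiteness makes the deviation vanish there. *)
Lemma optimal_unique z : optimal S0 eps Q theta eta z ->
  forall i, {ae P, forall w, z i w = x i}.
Proof.
move=> [adz zopt] i.
pose f v := 2^-1 * bform A (fun i => z i v - x i) (fun i => z i v - x i).
have f0 v : 0 <= f v by rewrite mulr_ge0 ?invr_ge0 ?bform_B_matrix_ge0.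
have intf : P.-integrable setT (EFin \o f) := integrable_excess adz.
have PT : (0 < P setT)%E by rewrite probability_setT.
(* An almost sure inequality holds at some outcome, as [P] has positive mass; one is enough, the
   excess integral being independent of [w]. *)
have [w zx] := @filter_ex _ _ (ae_properfilter_algebraOfSetsType PT) _
  (zopt _ admissible_optimal_trade).
have int0 : (\int[P]_v (f v)%:E = 0)%E.
  apply/eqP; rewrite eq_le integral_ge0 ?andbT => [|v _]; last by rewrite lee_fin.
  have finI : (\int[P]_v (f v)%:E)%E \is a fin_num.
    exact: (integrable_fin_num measurableT intf).
  move: zx; rewrite -lee_fin (expected_cost_excess w adz).
  by rewrite -(fineK finI) -EFinD !lee_fin gerDl.
have /ae_eq_integral_abs : (\int[P]_v `|(EFin \o f) v| = 0)%E.
  by rewrite -[RHS]int0; apply: eq_integral => v _; rewrite gee0_abs ?lee_fin.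
move=> /(_ measurableT (measurable_int _ intf)); apply: filterS => v /(_ I)[fv].
apply/eqP; rewrite -subr_eq0; apply/negP => /negP zxi.
suff : 0 < f v by rewrite fv ltxx.
by rewrite mulr_gt0 ?invr_gt0//; apply: B_matrix_pos_def => //; exists i.
Qed.

Lemma has_unique_solution_B_matrix : has_unique_solution S0 eps Q theta eta.
Proof.
exists (fun i => cst (x i)); first exact: optimal_optimal_trade.
by move=> z /optimal_unique.
Qed.

End execution_problem.

Theorem proposition4 (R : realType) (d : measure_display)
    (T : measurableType d) (P : probability T R) (N : nat) (hN : (1 <= N)%N)
    (S0 : R) (sigma : 'I_N -> R) (hsigma : forall i, 0 <= sigma i)
    (eps : 'I_N -> {RV P >-> R}) (heps : gaussian_noises sigma eps)
    (theta eta : 'rV[R]_N)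
    (htheta : forall i, 0 < theta 0 i) (heta : forall i, 0 < eta 0 i)
    (hA : B_matrix (impact_matrix theta eta)) :
  forall Q : R, 0 < Q ->
    has_unique_solution S0 eps Q theta eta /\
    strongly_well_posed S0 eps Q theta eta.
Proof.
move=> Q Q0; have sol := has_unique_solution_B_matrix S0 hN heps hA Q.
split => //; split; [split => //|].
- move=> xi /(optimal_unique hN heps hA) xiE e e0.
  have nearB : \forall u \near (Q, (theta, eta)),
      B_matrix (impact_matrix u.2.1 u.2.2).
    have : \forall D \near nbhs (theta, eta), B_matrix (impact_matrix D.1 D.2).
      exact: near_B_matrix.
    exact: cvg_snd.
  have near_coord (i : 'I_N) : \forall u \near (Q, (theta, eta)),
      `|optimal_trade (impact_matrix theta eta) Q i -
        optimal_trade (impact_matrix u.2.1 u.2.2) u.1 i| < e.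
    have /cvgrPdist_lt := cvg_optimal_trade (Q := Q) (i := i) hN hA.
    exact.
  have nearx := filter_forall (nbhs_filter (Q, (theta, eta))) near_coord.
  suff stab : \forall u \near (Q, (theta, eta)),
      positive_data u.1 u.2.1 u.2.2 ->
      has_unique_solution S0 eps u.1 u.2.1 u.2.2 /\
      forall zeta, optimal S0 eps u.1 u.2.1 u.2.2 zeta ->
        forall i, {ae P, forall w, `|zeta i w - xi i w| < e} by exact: stab.
  apply: filterS2 nearB nearx => -[q D]/= hB near_x _.
  (* The neighbouring matrix is still a B-matrix, so existence and uniqueness apply there; both
     solutions are almost surely deterministic and only their coordinates are compared. *)
  split; first exact: (has_unique_solution_B_matrix S0 hN heps hB q).
  move=> zeta /(optimal_unique hN heps hB) zetaE i.
  apply: filterS2 (zetaE i) (xiE i) => w -> ->.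
  by rewrite distrC.
- move=> xi /(optimal_unique hN heps hA) xiE i.
  apply: filterS (xiE i) => w ->; apply: optimal_trade_le0 => //; last exact: ltW.
  by move=> k l; exact: impact_matrix_sym.
Qed.
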